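(* Let $C\subset\mathbb{R}^N$ ($N\ge2$) be a compact convex set with non-empty interior and $C^{1,1}$ boundary, let $\Omega\in\mathcal{O}_C$, and let $F=\pi\circ\Phi:\partial C\to\partial C$ be the return map. Then there exists a bijective correspondence between orbits of $F$ and pairs of points $(c,x)\in\partial C\times(\partial\Omega\setminus C)$ satisfying the geometric closure system $$\begin{cases} x=c+d(c)\nu(c) & \text{(outward radial link)}\\ c'=x+t(x)n(x) & \text{(inward normal link)}\\ c'=F(c) & \text{(cycle closure)}\end{cases}$$ Moreover, the displacement $F(c)-c$ admits the exact factorization $$F(c)-c=d(c)\nu(c)+t(\Phi(c))\,n(\Phi(c)),$$ where the first term depends only on the geometry of $\partial C$ and $d$, while the second term depends on the global geometry of $\partial\Omega$ via the reciprocal map $\pi$. This factorization shows that all nonlinearity in $F$ originates from the deflection of the inward normal $n(\Phi(c))$ relative to $-\nu(c)$.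
   Context: $\nu(c)$ is the outward unit normal to $\partial C$ at $c$; $n(x)$ is the inward unit normal to $\partial\Omega$ at $x$. An open set $\Omega$ containing $C$ satisfies the $C$-geometric normal property ($C$-GNP) if for every $x\in\partial\Omega\setminus C$ where $n(x)$ exists, the half-line $\{x+t\,n(x):t\ge 0\}$ intersects $C$, and the first intersection point is unique and belongs to $\partial C$. $\mathcal{O}_C$ is the collection of open sets $\Omega\subset\mathbb{R}^N$ such that: (1) $\operatorname{int}(C)\subset\Omega$; (2) $\partial\Omega$ is $C^{1,1}$ (outside $C$) and $\partial\Omega\setminus C$ is orientable; (3) for every $c\in\partial C$ the outward normal ray $\{c+t\nu(c):t>0\}$ intersects $\partial\Omega$ at exactly one point, and the intersection is transverse; (4) $\Omega$ satisfies the $C$-GNP. The thickness function $d:\partial C\to\mathbb{R}_+$ is defined by: $d(c)$ is the unique $t>0$ with $c+t\nu(c)\in\partial\Omega$. The radial map is $\Phi:\partial C\to\partial\Omega\setminus C$, $\Phi(c)=c+d(c)\nu(c)$. The reciprocal map $\pi:\partial\Omega\setminus C\to\partial C$ sends $x$ to the (first) intersection point of the inward normal ray $\{x+t\,n(x):t\ge0\}$ with $\partial C$; $t(x)>0$ is the intersection time, defined by $\pi(x)=x+t(x)n(x)$. The return map is $F=\pi\circ\Phi$. An orbit of $F$ is a sequence $(c_k)_{k\ge0}$ in $\partial C$ with $c_0\in\partial C$ and $c_{k+1}=F(c_k)$. In the closure system, $c'\in\partial C$ denotes the next point on the orbit. *)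

(* Defs.v *)
From HB Require Import structures.
From mathcomp Require Import all_boot all_order all_algebra.
From mathcomp Require Import all_classical all_reals all_analysis.

Set Implicit Arguments.
Unset Strict Implicit.
Unset Printing Implicit Defensive.

Import Order.TTheory GRing.Theory Num.Theory.
Import numFieldNormedType.Exports.

Local Open Scope classical_set_scope.
Local Open Scope ring_scope.

Section Geometry.
Context {R : realType} {N : nat}.
Notation V := 'rV[R]_N.
Implicit Types (A S U : set V) (x v p : V) (phi : V -> R).

(* The library norm `|v| on 'rV[R]_N is the sup norm: unit vectors must be
   taken with respect to the Euclidean norm [enorm] instead.  The topology and
   the class of Lipschitz maps are the same for both norms. *)
Definition dotv (u v : V) : R := (u *m v^T) 0 0.

Definition enorm v : R := Num.sqrt (dotv v v).

Definition boundary A : set V := closure A `\` A°.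

Definition gradient phi x : V := \row_i 'd phi x (delta_mx 0 i).

(* On the open set U, A is the regular sublevel set {phi < 0} of a C^1
   function.  This is the notion of a C^1 domain: A lies locally on one side of
   its boundary, so that "outward" and "inward" make sense. *)
Definition C1_defining_function A U phi : Prop :=
  [/\ open U,
      (forall y, U y -> differentiable phi y /\ gradient phi y != 0),
      {within U, continuous (gradient phi)},
      A° `&` U = [set y | phi y < 0] `&` U &
      boundary A `&` U = [set y | phi y = 0] `&` U].

Definition C11_boundary_at A x : Prop :=
  exists U phi,
    [/\ U x, C1_defining_function A U phi &
        [lipschitz (gradient phi y) | y in U]].

Definition is_outward_normal A x v : Prop :=
  exists U phi,
    [/\ U x, boundary A x, C1_defining_function A U phi &
        v = (enorm (gradient phi x))^-1 *: gradient phi x].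

Definition is_inward_normal A x v : Prop := is_outward_normal A x (- v).

Definition outward_normal A x : V := get (is_outward_normal A x).

Definition inward_normal A x : V := get (is_inward_normal A x).

(* S is a relatively open piece of the hypersurface boundary A; it is
   orientable when it carries a continuous field of unit normals. *)
Definition orientable_boundary A S : Prop :=
  exists m : V -> V, {within S, continuous m} /\
    forall x, S x -> is_outward_normal A x (m x) \/ is_inward_normal A x (m x).

(* p is the first point of S on the half-line {x + t v : t >= 0} *)
Definition first_hit S x v p : Prop :=
  exists t : R, [/\ 0 <= t, p = x + t *: v, S p &
    forall s : R, 0 <= s -> s < t -> ~ S (x + s *: v)].

End Geometry.

Section ReturnMap.
Context {R : realType} {N : nat}.
Notation V := 'rV[R]_N.
Implicit Types (C Omega : set V) (c x : V).

Definition C_GNP C Omega : Prop :=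
  forall x v, (boundary Omega `\` C) x -> is_inward_normal Omega x v ->
    exists p, boundary C p /\ unique (first_hit C x v) p.

Definition O_class C : set (set V) := [set Omega |
  [/\ open Omega,
      C° `<=` Omega,
      (forall x, (boundary Omega `\` C) x -> C11_boundary_at Omega x) /\
        orientable_boundary Omega (boundary Omega `\` C),
      (forall c, boundary C c ->
        exists t : R,
          unique (fun s : R =>
            0 < s /\ boundary Omega (c + s *: outward_normal C c)) t /\
          (* transversality: the ray is not tangent to boundary Omega *)
          dotv (outward_normal C c)
            (inward_normal Omega (c + t *: outward_normal C c)) != 0) &
      C_GNP C Omega]].

Definition thickness C Omega c : R :=
  get [set t : R | 0 < t /\ boundary Omega (c + t *: outward_normal C c)].

Definition radial_map C Omega c : V :=
  c + thickness C Omega c *: outward_normal C c.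

Definition reciprocal_map C Omega x : V :=
  get (first_hit (boundary C) x (inward_normal Omega x)).

Definition hit_time C Omega x : R :=
  get [set t : R | 0 < t /\
    reciprocal_map C Omega x = x + t *: inward_normal Omega x].

Definition return_map C Omega : V -> V :=
  reciprocal_map C Omega \o radial_map C Omega.

Definition orbits C Omega : set (nat -> V) := [set s |
  (forall k, boundary C (s k)) /\
  (forall k, s k.+1 = return_map C Omega (s k))].

Definition closure_system C Omega c x c' : Prop :=
  [/\ x = c + thickness C Omega c *: outward_normal C c,
      c' = x + hit_time C Omega x *: inward_normal Omega x &
      c' = return_map C Omega c].

Definition closure_pairs C Omega : set (V * V) := [set p |
  [/\ boundary C p.1, (boundary Omega `\` C) p.2 &
      exists2 c', boundary C c' & closure_system C Omega p.1 p.2 c']].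

End ReturnMap.

(* Main.v *)
(* At a boundary point c the defining function of C has positive derivative
   along nu(c), so the normal ray leaves C at once; by convexity it never comes
   back.  Hence Phi(c) is not in C, the hitting time of Phi(c) is positive, and
   if n(Phi(c)) = - nu(c) the inward ray first meets C at c itself.  An orbit is
   determined by its starting point, and so is a solution of the closure system,
   which gives the bijection. *)
Require Import Defs.
From mathcomp Require Import all_boot all_order all_algebra.
From mathcomp Require Import all_classical all_reals all_analysis.
Import Order.TTheory GRing.Theory Num.Theory.
Import numFieldNormedType.Exports.
Local Open Scope classical_set_scope.
Local Open Scope ring_scope.

Lemma dotvE (R : realType) (N : nat) (u v : 'rV[R]_N) :
  dotv u v = \sum_i u 0 i * v 0 i.
Proof. by rewrite /dotv mxE; apply: eq_bigr => i _; rewrite mxE. Qed.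

Lemma dotv_gt0 (R : realType) (N : nat) (v : 'rV[R]_N) :
  v != 0 -> 0 < dotv v v.
Proof.
move=> v0; rewrite dotvE lt_neqAle eq_sym sumr_ge0 ?andbT; last first.
  by move=> i _; rewrite -expr2 sqr_ge0.
apply: contra v0; rewrite psumr_eq0 => [/allP vv0|i _]; last first.
  by rewrite -expr2 sqr_ge0.
apply/eqP/rowP => i; rewrite mxE; apply/eqP.
by have := vv0 i (mem_index_enum i); rewrite /= mulf_eq0 orbb.
Qed.

Lemma diff_gradient (R : realType) (N : nat) (phi : 'rV[R]_N -> R)
    (x v : 'rV[R]_N) :
  differentiable phi x -> 'd phi x v = dotv v (gradient phi x).
Proof.
move=> dphi; rewrite dotvE {1}[v]row_sum_delta linear_sum.
by apply: eq_bigr => i _; rewrite linearZ /= mxE.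
Qed.

Lemma boundary_sub_closed {R : realType} {N : nat} {C : set 'rV[R]_N} :
  closed C -> boundary C `<=` C.
Proof. by move=> C_closed x [+ _]; exact: C_closed. Qed.

(** [get] returns a genuine normal as soon as one exists, and a local defining function provides
    one: its normalized gradient. *)
Lemma outward_normalP {R : realType} {N : nat} {A : set 'rV[R]_N} {x} :
  boundary A x -> C11_boundary_at A x ->
  is_outward_normal A x (outward_normal A x).
Proof.
move=> bAx [U [phi [Ux Uphi _]]]; apply: getPex.
by exists ((enorm (gradient phi x))^-1 *: gradient phi x), U, phi.
Qed.

Lemma inward_normalP {R : realType} {N : nat} {A : set 'rV[R]_N} {x} :
  boundary A x -> C11_boundary_at A x ->
  is_inward_normal A x (inward_normal A x).
Proof.
move=> bAx [U [phi [Ux Uphi _]]]; apply: getPex.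
exists (- ((enorm (gradient phi x))^-1 *: gradient phi x)).
by rewrite /is_inward_normal opprK; exists U, phi.
Qed.

Lemma outward_normal_leaves (R : realType) (N : nat) (A : set 'rV[R]_N) x v :
  is_outward_normal A x v -> \forall s \near 0^'+, ~ A (x + s *: v).
Proof.
move=> [U [phi [Ux bAx [openU dphi _ intA bdA] ->]]].
have [dphix gx0] := dphi x Ux.
set g := gradient phi x in gx0 *; set v' := _ *: g.
have phix0 : phi x = 0.
  by have [] : ([set y | phi y = 0] `&` U) x by rewrite -bdA.
have Dgt0 : 0 < 'D_v' phi x.
  rewrite deriveE // diff_gradient // /v' -/g.
  have -> : dotv ((enorm g)^-1 *: g) g = (enorm g)^-1 * dotv g g.
    by rewrite /dotv -scalemxAl mxE.
  by rewrite mulr_gt0 ?dotv_gt0 // invr_gt0 sqrtr_gt0 dotv_gt0.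
(* The quotient tends to the positive derivative [Dgt0]; keeping [h > 0] gives [phi] the sign of the
   quotient, since [phi x = 0]. *)
have quot : \forall h \near 0^'+, 0 < h^-1 *: (phi (h *: v' + x) - phi x).
  have : \forall h \near 0^', 0 < h^-1 *: (phi (h *: v' + x) - phi x).
    have dphixv : derivable phi x v' by exact: diff_derivable.
    exact: (cvgr_gt _ dphixv _ Dgt0).
  rewrite !near_withinE; apply: filterS => h + h0; apply.
  by rewrite gt_eqF.
have inU : \forall h \near 0^'+, U (x + h *: v').
  have cvgx : x + h *: v' @[h --> 0^'+] --> x.
    apply: cvg_at_right_filter.
    rewrite -[X in _ --> X]addr0 -(scale0r v').
    by apply: cvgD; [exact: cvg_cst|apply: cvgZl; exact: cvg_id].
  exact: cvgx (open_nbhs_nbhs (conj openU Ux)).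
near=> h => Ah.
have h0 : 0 < h by near: h; exact: nbhs_right_gt.
have Uh : U (x + h *: v') by near: h.
have phih : 0 < phi (x + h *: v').
  have : 0 < h^-1 *: (phi (h *: v' + x) - phi x).
    by near: h.
  by rewrite phix0 subr0 addrC pmulr_rgt0 // invr_gt0.
(* Within [U], a point of [A] is interior, where [phi < 0], or on the boundary, where [phi = 0];
   either contradicts [phih]. *)
have [iAh|niAh] := pselect (A° (x + h *: v')).
  have [/= + _] : ([set y | phi y < 0] `&` U) (x + h *: v') by rewrite -intA.
  by move=> /(lt_trans phih); rewrite ltxx.
have [/= phih0 _] : ([set y | phi y = 0] `&` U) (x + h *: v').
  by rewrite -bdA; split=> //; split=> //; exact: subset_closure.
by rewrite phih0 ltxx in phih.
Unshelve. all: by end_near.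
Qed.

(** A return at time [s] would put the whole segment from [c] into [C], including the point at a
    small time [e <= s], with weight [e / s], which is already known to lie outside. *)
Lemma outward_ray_avoids_convex {R : realType} {N : nat} {C : set 'rV[R]_N}
    {c v : 'rV[R]_N} :
  convex_set (C : set (convex_lmodType 'rV[R]_N)) -> C c ->
  is_outward_normal C c v -> forall s : R, 0 < s -> ~ C (c + s *: v).
Proof.
move=> C_convex Cc /outward_normal_leaves leaves s s0 Cs.
near (0 : R)^'+ => e.
have : ~ C (c + e *: v) by near: e.
have e0 : 0 <= e by near: e; exact: nbhs_right_ge.
have es : e <= s by near: e; exact: nbhs_right_le.
have es0 : 0 <= e / s by rewrite divr_ge0 // ltW.
have es1 : e / s <= 1 by rewrite ler_pdivrMr // mul1r.
apply; apply/set_mem.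
have -> : c + e *: v = (e / s) *: (c + s *: v) + (1 - e / s) *: c.
  rewrite scalerDr scalerA divfK ?gt_eqF // addrAC -scalerDl.
  by rewrite addrCA subrr addr0 scale1r.
by apply: (C_convex _ _ (Itv01 es0 es1)); exact: mem_set.
Unshelve. all: by end_near.
Qed.

Lemma first_hit_inj {R : realType} {N : nat} {S : set 'rV[R]_N}
    {x v p q : 'rV[R]_N} :
  first_hit S x v p -> first_hit S x v q -> p = q.
Proof.
move=> [s [s0 -> Ss smin]] [t [t0 -> St tmin]].
by case: (ltgtP s t) => [/(tmin _ s0)|/(smin _ t0)|->].
Qed.

Section AdmissibleSet.
Context {R : realType} {N : nat} {C Omega : set 'rV[R]_N}.
Hypothesis C_compact : compact C.
Hypothesis C_convex : convex_set (C : set (convex_lmodType 'rV[R]_N)).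
Hypothesis C_C11 : forall c, boundary C c -> C11_boundary_at C c.
Hypothesis hOmega : O_class C Omega.

Let C_closed : closed C.
Proof. by apply: compact_closed => //; exact: norm_hausdorff. Qed.

Lemma outward_normal_ray_avoids {c} : boundary C c ->
  forall s : R, 0 < s -> ~ C (c + s *: outward_normal C c).
Proof.
move=> bc; apply: outward_ray_avoids_convex => //.
  exact: boundary_sub_closed.
by apply: outward_normalP => //; exact: C_C11.
Qed.

Lemma thicknessP {c} : boundary C c ->
  0 < thickness C Omega c /\ boundary Omega (radial_map C Omega c).
Proof.
move=> bc; have [_ _ _ /(_ c bc)[t [[tP _] _]] _] := hOmega.
by apply: (@getPex _ [set t : R | 0 < t /\
  boundary Omega (c + t *: outward_normal C c)]); exists t.
Qed.

Lemma radial_map_fun :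
  set_fun (boundary C) (boundary Omega `\` C) (radial_map C Omega).
Proof.
move=> c bc; have [d0 bPhi] := thicknessP bc.
by split=> //; exact: outward_normal_ray_avoids.
Qed.

(** The geometric normal property concerns the first hit of [C], while [reciprocal_map] selects the
    first hit of [boundary C]. The former lies in [boundary C], and an earlier point of [boundary C]
    would be an earlier point of the closed set [C], so it is also the latter. *)
Lemma reciprocal_mapP {x} : (boundary Omega `\` C) x ->
  first_hit (boundary C) x (inward_normal Omega x) (reciprocal_map C Omega x).
Proof.
move=> bx; have [_ _ [reg _] _ gnp] := hOmega.
have [p [bp [[t [t0 px _ tmin]] _]]] :=
  gnp x _ bx (inward_normalP bx.1 (reg x bx)).
apply: getPex; exists p, t; split=> // s s0 st bs.
by apply: (tmin s s0 st); exact: boundary_sub_closed bs.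
Qed.

Lemma reciprocal_map_fun :
  set_fun (boundary Omega `\` C) (boundary C) (reciprocal_map C Omega).
Proof. by move=> x /reciprocal_mapP[t []]. Qed.

Lemma reciprocal_mapE {x} : (boundary Omega `\` C) x ->
  reciprocal_map C Omega x = x + hit_time C Omega x *: inward_normal Omega x.
Proof.
move=> bx; have [t [t0 pix bpi _]] := reciprocal_mapP bx.
suff [] : [set t : R | 0 < t /\ reciprocal_map C Omega x =
    x + t *: inward_normal Omega x] (hit_time C Omega x) by [].
apply: getPex; exists t; split=> //.
(* A zero hitting time would place [x] itself in [C]. *)
rewrite lt_neqAle t0 andbT; apply/eqP => t_eq0; apply: bx.2.
by move: bpi; rewrite pix -t_eq0 scale0r addr0; exact: boundary_sub_closed.
Qed.

Lemma return_map_fun :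
  set_fun (boundary C) (boundary C) (return_map C Omega).
Proof. by move=> c /radial_map_fun /reciprocal_map_fun. Qed.

Lemma return_mapE {c} : boundary C c ->
  return_map C Omega c = radial_map C Omega c +
    hit_time C Omega (radial_map C Omega c) *:
      inward_normal Omega (radial_map C Omega c).
Proof. by move=> /radial_map_fun /reciprocal_mapE. Qed.

(** The inward ray retraces the outward one: it reaches [c] at time [thickness C Omega c], and at
    earlier times it is still strictly ahead of [c] on the outward ray, outside [C]. *)
Lemma return_map_fixed {c} : boundary C c ->
  inward_normal Omega (radial_map C Omega c) = - outward_normal C c ->
  return_map C Omega c = c.
Proof.
move=> bc nE; have [d0 _] := thicknessP bc.
have hit := reciprocal_mapP (radial_map_fun _ bc).
apply: (first_hit_inj hit); rewrite nE; exists (thickness C Omega c).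
split=> [||//|s s0 sd].
- exact: ltW.
- by rewrite scalerN addrK.
- rewrite scalerN -addrA -scalerBl => /(boundary_sub_closed C_closed).
  by apply: outward_normal_ray_avoids; rewrite // subr_gt0.
Qed.

Lemma orbit_iter {s} : orbits C Omega s ->
  forall k, s k = iter k (return_map C Omega) (s 0%N).
Proof. by move=> [_ sS]; elim=> [|k IHk]; [|rewrite iterS -IHk]. Qed.

Lemma closure_systemP {c} : boundary C c ->
  closure_system C Omega c (radial_map C Omega c) (return_map C Omega c).
Proof. by move=> bc; split=> //; exact: return_mapE. Qed.

(** Injectivity: an orbit consists of the iterates of its initial point. Surjectivity: the radial
    link forces [x] to be the radial image of [c], and iterating from [c] gives the orbit. *)
Lemma orbits_closure_pairs_bij :
  set_bij (orbits C Omega) (closure_pairs C Omega)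
    (fun s => (s 0%N, radial_map C Omega (s 0%N))).
Proof.
split.
- move=> s [bs _]; split; first exact: bs.
    exact: radial_map_fun.
  exists (return_map C Omega (s 0%N)); first exact: return_map_fun.
  exact: closure_systemP (bs 0%N).
- move=> s1 s2 /set_mem os1 /set_mem os2 /(congr1 fst) s12.
  by apply/funext => k; rewrite (orbit_iter os1) (orbit_iter os2) [s1 0%N]s12.
- move=> [c x] [/= bc _ [c' _ [-> _ _]]].
  exists (fun k => iter k (return_map C Omega) c); last by [].
  by split=> //; elim=> [|k IHk]; [|exact: return_map_fun].
Qed.

End AdmissibleSet.


Theorem proposition10p1 (R : realType) (N : nat) (hN : (2 <= N)%N)
  (C : set 'rV[R]_N)
  (C_compact : compact C)
  (C_convex : convex_set (C : set (convex_lmodType 'rV[R]_N)))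
  (C_interior : C° !=set0)
  (C_C11 : forall c, boundary C c -> C11_boundary_at C c)
  (Omega : set 'rV[R]_N) (hOmega : O_class C Omega) :
  let nu := outward_normal C in
  let n := inward_normal Omega in
  let d := thickness C Omega in
  let Phi := radial_map C Omega in
  let pi := reciprocal_map C Omega in
  let t := hit_time C Omega in
  let F := return_map C Omega in
  (* Phi, pi and F are maps between the announced sets *)
  [/\ set_fun (boundary C) (boundary Omega `\` C) Phi,
      set_fun (boundary Omega `\` C) (boundary C) pi &
      set_fun (boundary C) (boundary C) F] /\
  (* orbits correspond to solutions of the closure system, with c the initial
     point of the orbit and c' the next one *)
  (exists f : (nat -> 'rV[R]_N) -> 'rV[R]_N * 'rV[R]_N,
    set_bij (orbits C Omega) (closure_pairs C Omega) f /\
    forall s, orbits C Omega s ->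
      exists2 x, f s = (s 0%N, x) & closure_system C Omega (s 0%N) x (s 1%N)) /\
  (forall c, boundary C c ->
    [/\ F c - c = d c *: nu c + t (Phi c) *: n (Phi c),
        (* the second term depends on Omega via pi *)
        t (Phi c) *: n (Phi c) = pi (Phi c) - Phi c,
        (* the first term depends on Omega only through d: it cancels between two
           admissible sets with the same thickness at c *)
        (forall Omega', O_class C Omega' -> thickness C Omega' c = d c ->
          return_map C Omega' c - F c =
          hit_time C Omega' (Phi c) *: inward_normal Omega' (Phi c)
          - t (Phi c) *: n (Phi c)) &
        (* without deflection of the inward normal from - nu, F is the
           identity *)
        n (Phi c) = - nu c -> F c = c]).
Proof.
move=> nu n d Phi pi t F.
split; last split.
- split; [exact: radial_map_fun | exact: reciprocal_map_fun |
    exact: return_map_fun].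
- exists (fun s : nat -> 'rV[R]_N => (s 0%N, Phi (s 0%N))); split.
    exact: orbits_closure_pairs_bij.
  move=> s [bs sS]; exists (Phi (s 0%N)) => //.
  by rewrite sS; apply: closure_systemP; [..|exact: bs 0%N].
- move=> c bc; have PhiE : Phi c = c + d c *: nu c by [].
  have FE : F c = Phi c + t (Phi c) *: n (Phi c) by exact: return_mapE.
  split.
  + rewrite FE; move: (t _ *: n _) => T; rewrite PhiE.
    by rewrite addrC addrA addKr.
  + by apply/esym; rewrite -[pi _]/(F c) FE addrC addKr.
  + move=> Omega' hOmega' d'E.
    (* [Omega'] enters the radial map at [c] only through its thickness there, so both sets share
       the point [Phi c], which cancels from the difference. *)
    have Phi'E : radial_map C Omega' c = Phi c.
      by rewrite /radial_map d'E; exact: esym PhiE.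
    have := return_mapE C_compact C_convex C_C11 hOmega' bc.
    rewrite Phi'E => ->; rewrite FE.
    by rewrite opprD addrACA subrr add0r.
  + exact: return_map_fixed.
Qed.
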